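(* Let $\Gamma$ be a tree with vertex set $V$, fix a vertex $v_0$ of $\Gamma$, and for $n\ge0$ let $V_n$ be the set of vertices $v$ with $l(v_0,v)=n$. Let $V=\bigcup_{n\ge0}V_n$ be well-ordered so that $v_0$ is the smallest element and $v<v'$ whenever $v\in V_i$, $v'\in V_j$ with $i<j$. Let $$R_\Gamma=\{[v',v]=0\mid v'\in V_{n+1},\ v\in V_n,\ v'\text{ and }v\text{ are adjacent},\ n\ge0\}.$$ Then the relation set $R_\Gamma$ forms a Gröbner–Shirshov basis for the partial commutative metabelian Lie algebra $\mathcal{ML}_\Gamma=\mathcal{L}_{(2)}(V|R_\Gamma)$ related to the tree $\Gamma$.
   Context: A tree is a connected non-empty graph without circuits; $l(v,v')$ is the distance between $v$ and $v'$, i.e. the length of the path without backtracking from $v$ to $v'$. $\mathbf{k}$ is a field of arbitrary characteristic. $\mathcal{L}_{(2)}(X)=Lie(X)/Lie(X)^{(2)}$ is the free metabelian Lie algebra over $\mathbf{k}$ on the well-ordered set $X$, where $\mathcal{L}^{(0)}=\mathcal{L}$, $\mathcal{L}^{(n+1)}=[\mathcal{L}^{(n)},\mathcal{L}^{(n)}]$; $\mathcal{L}_{(2)}(X|S)=\mathcal{L}_{(2)}(X)/Id(S)$, where $Id(S)$ is the ideal generated by $S$ (a relation $h=0$ stands for the polynomial $h$). The Lie product is written $uv$, $u\cdot v$ or $[u,v]$; products without brackets are left-normed. ''A Gröbner–Shirshov basis for $\mathcal{L}_{(2)}(X|S)$'' is a Gröbner–Shirshov basis in $\mathcal{L}_{(2)}(X)$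 generating $Id(S)$. Words. $[X]$ is the free commutative monoid on $X$; $\langle a_{1}\cdots a_{m}\rangle$ denotes the letters rearranged in non-decreasing order. $R=\{a_0a_1\cdots a_n \mid n\ge1,\ a_i\in X,\ a_0>a_1\le a_2\le\cdots\le a_n\}$ and $N=X\cup R$ (regular words), a $\mathbf{k}$-basis of $\mathcal{L}_{(2)}(X)$. Each $f$ is uniquely $f=f^{(1)}+f^{(0)}$, $f^{(1)}\in\mathbf{k}R$, $f^{(0)}\in\mathbf{k}X$. Length: $|a|=1$ for $a\in X$, $|a_0a_1\cdots a_n|=n+1$. $N$ is ordered degree-lexicographically (first by length, then lexicographically). For $f\ne0$, $\bar f$ is the largest word occurring in $f$ with nonzero coefficient (leading word); $f$ is monic if the coefficient of $\bar f$ is $1$. Conditions mentioning $\bar h$ presuppose $h\ne0$. Normal $S$-words: (i) $sa_1a_2\cdots a_n$ with $s\in S$, $n\ge0$, $a_i\in X$, $a_1\le\cdots\le a_n$, $\bar s\ne a_1$ (no condition on letters if $n=0$); (ii) $us$ with $u\in R$, $s\in S$, $\bar s\neq u$. Compositions. Let $f,g$ be monic, $\alpha,\beta$ the coefficients of $\overline{f^{(0)}}$, $\overline{g^{(0)}}$ in $f$, $g$. $f\langle c_1\cdots c_r\rangle$ is the left-normed product of $f$ by the letters in non-decreasing order; a hat means omission. Type I: $\bar f=a_0a_1\cdots a_n$, $\bar g=a_0b_1\cdots b_m$ ($n,m\ge0$), $L$ the least common multiple in $[X]$ of $a_1\cdots a_n$ and $b_1\cdots b_m$, $w=a_0\langle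 L\rangle$: $C_I(f,g)_w=f\langle L/(a_1\cdots a_n)\rangle-g\langle L/(b_1\cdots b_m)\rangle$. Type II: $\bar f=\overline{f^{(1)}}=a_0a_1\cdots a_n$, and $\overline{g^{(0)}}=a_i$ for some $i\ge2$, or $\overline{g^{(0)}}=a_1$ (put $i=1$) and $a_0>a_2$; $w=\bar f$: $C_{II}(f,g)_w=f-\beta^{-1}a_0a_1\cdots\hat{a_i}\cdots a_n\cdot g$. Type III: $\bar f=\overline{f^{(1)}}=a_0a_1\cdots a_n$, $\bar g=\overline{g^{(0)}}=a_1$, and $a_0\le a_2$ or $n=1$; $w=\bar f$: $C_{III}(f,g)_w=f+ga_0a_2\cdots a_n$. Type IV: $\bar f=\overline{f^{(1)}}=a_0a_1\cdots a_n$, $g^{(1)}\ne0$, $\overline{g^{(0)}}=a_1$, and $a_0\le a_2$ or $n=1$; for any $a\in X$ with $a<a_0$, $w=a_0\langle a_1\cdots a_na\rangle$: $C_{IV}(f,g)_w=fa-\beta^{-1}a_0aa_2\cdots a_n\cdot g$. Type V: $\bar f=\overline{f^{(1)}}=a_0a_1\cdots a_n$, $f^{(0)}\ne0$, $g^{(1)}\ne0$, $\overline{g^{(0)}}=b\notin\{a_i\}_{i=1}^n$; $w=a_0\langle a_1\cdots a_nb\rangle$: $C_V(f,g)_w=fb-\beta^{-1}a_0a_1\cdots a_n\cdot g$. Type VI: $\overline{f^{(0)}}=\overline{g^{(0)}}=a$, $f^{(1)}\ne0$; for any $a_0a_1\in R$, $w=a_0\langle a_1a\rangle$: $C_{VI}(f,g)_w=(a_0a_1)(\alpha^{-1}f-\beta^{-1}g)$.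 Type VII: $f^{(1)}\ne0$, $g^{(1)}\ne0$, $\overline{f^{(0)}}=a>\overline{g^{(0)}}=b$; for any $a_0\in X$, $a_0>a$, $w=a_0ba$: $C_{VII}(f,g)_w=\alpha^{-1}(a_0b)f-\beta^{-1}(a_0a)g$. Triviality: for a set $S$ of monic polynomials and $w\in N$, $f\equiv0\ mod(S,w)$ means that $f$ is a $\mathbf{k}$-linear combination of normal $S$-words $u_s$ with $\overline{u_s}<w$. $S$ is a Gröbner–Shirshov basis if $C_\lambda(f,g)_w\equiv0\ mod(S,w)$ for all $f,g\in S$ and all compositions. *)

(* Defs.v *)
From HB Require Import structures.
From mathcomp Require Import all_boot all_order all_algebra.
From mathcomp Require Import generic_quotient finmap multiset.
From mathcomp Require Import boolp classical_sets.

Set Implicit Arguments.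
Unset Strict Implicit.
Unset Printing Implicit Defensive.

Import Order.TTheory GRing.Theory.
Local Open Scope ring_scope.
Local Open Scope quotient_scope.
Local Open Scope classical_set_scope.

HB.mixin Record isLieAlgebra (k : fieldType) L of GRing.Lmodule k L := {
  lie : L -> L -> L;
  lie_linearl : forall a x y z, lie (a *: x + y) z = a *: lie x z + lie y z;
  lie_linearr : forall a x y z, lie z (a *: x + y) = a *: lie z x + lie z y;
  liexx : forall x, lie x x = 0;
  lie_jacobi : forall x y z,
    lie x (lie y z) + lie y (lie z x) + lie z (lie x y) = 0
}.

#[short(type="lieAlgType")]
HB.structure Definition LieAlgebra (k : fieldType) :=
  { L of isLieAlgebra k L & GRing.Lmodule k L }.

Section LieTheory.
Variables (k : fieldType) (L : lieAlgType k).
Implicit Types (x y z : L) (A B : set L).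

Lemma lieDl x y z : lie (x + y) z = lie x z + lie y z.
Proof. by have := lie_linearl 1 x y z; rewrite !scale1r. Qed.

Lemma lieDr x y z : lie z (x + y) = lie z x + lie z y.
Proof. by have := lie_linearr 1 x y z; rewrite !scale1r. Qed.

Lemma lie0x x : lie 0 x = 0.
Proof. by apply: (addrI (lie 0 x)); rewrite -lieDl !addr0. Qed.

Lemma liex0 x : lie x 0 = 0.
Proof. by apply: (addrI (lie x 0)); rewrite -lieDr !addr0. Qed.

Lemma lieZl a x y : lie (a *: x) y = a *: lie x y.
Proof. by have := lie_linearl a x 0 y; rewrite lie0x !addr0. Qed.

Lemma lieZr a x y : lie y (a *: x) = a *: lie y x.
Proof. by have := lie_linearr a x 0 y; rewrite liex0 !addr0. Qed.

Lemma lieC x y : lie x y = - lie y x.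
Proof.
apply/eqP; rewrite -addr_eq0; have := liexx (x + y).
by rewrite lieDl !lieDr !liexx add0r addr0 => ->.
Qed.

Lemma lieNl x y : lie (- x) y = - lie x y.
Proof. by rewrite -scaleN1r lieZl scaleN1r. Qed.

Lemma lieNr x y : lie x (- y) = - lie x y.
Proof. by rewrite lieC lieNl -lieC. Qed.

Lemma lie_derivation x y z : lie x (lie y z) = lie (lie x y) z + lie y (lie x z).
Proof.
apply/eqP; rewrite -subr_eq0 opprD addrA addrAC.
by rewrite -(lieNr y (lie x z)) -(lieC z x) -(lieC z (lie x y)) lie_jacobi.
Qed.

Definition lspan A : set L :=
  [set x | exists s : seq (k * L),
     (forall p, p \in s -> A p.2) /\ x = \sum_(p <- s) p.1 *: p.2].

Definition is_ideal A :=
  [/\ A 0, (forall a x y, A x -> A y -> A (a *: x + y))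
    & forall x y, A y -> A (lie x y)].

Definition ideal_gen A : set L :=
  [set x | forall J, is_ideal J -> A `<=` J -> J x].

(* [A, B] is the linear span of the brackets, and L^(0) = L,
   L^(n+1) = [L^(n), L^(n)]. *)
Definition lie_prod A B : set L := lspan [set lie a b | a in A & b in B].

Fixpoint derived n : set L :=
  if n is m.+1 then lie_prod (derived m) (derived m) else setT.

Lemma lspan_lin A a x y : lspan A x -> lspan A y -> lspan A (a *: x + y).
Proof.
move=> [s [sA ->]] [t [tA ->]]; exists ([seq (a * p.1, p.2) | p <- s] ++ t).
split=> [p|].
  by rewrite mem_cat => /orP[/mapP[q /sA qA ->]|/tA].
rewrite big_cat big_map scaler_sumr; congr (_ + _).
by apply: eq_bigr => p _; rewrite scalerA.
Qed.

Lemma lspan0 A : lspan A 0.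
Proof. by exists [::]; rewrite big_nil. Qed.

Lemma sub_lspan A : A `<=` lspan A.
Proof.
move=> x Ax; exists [:: (1, x)]; rewrite big_seq1 scale1r; split=> // p.
by rewrite inE => /eqP ->.
Qed.

Lemma derived_ideal n : is_ideal (derived n).
Proof.
elim: n => [|n [_ _ IHn]] //=; split; [exact: lspan0|exact: lspan_lin|].
move=> x _ [s [sA ->]].
elim: s sA => [|p s IHs] sA; first by rewrite big_nil liex0; apply: lspan0.
have ps q : q \in s -> q \in p :: s by rewrite inE orbC => ->.
rewrite big_cons lieDr lieZr; apply: lspan_lin; last first.
  by apply: IHs => q /ps /sA.
have [a Aa [b Ab <-]] := sA p (mem_head _ _).
rewrite lie_derivation -[lie (lie x a) b]scale1r; apply: lspan_lin.
  by apply: sub_lspan; exists (lie x a); [exact: IHn | exists b].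
by apply: sub_lspan; exists a => //; exists (lie x b); first exact: IHn.
Qed.

Record lie_ideal := LieIdeal { ideal_set :> set L; _ : is_ideal ideal_set }.

Lemma lie_idealP (J : lie_ideal) : is_ideal J. Proof. by case: J. Qed.

Definition derived_lie_ideal n := LieIdeal (derived_ideal n).

End LieTheory.

Section LieQuotient.
Variables (k : fieldType) (L : lieAlgType k) (J : lie_ideal L).

Definition ideal_equiv : rel L := fun x y => `[< ideal_set J (x - y) >].

Let J0 : ideal_set J 0. Proof. by case: (lie_idealP J). Qed.
Let Jlin a x y : ideal_set J x -> ideal_set J y -> ideal_set J (a *: x + y).
Proof. by case: (lie_idealP J) => _ + _; apply. Qed.
Let Jlie x y : ideal_set J y -> ideal_set J (lie x y).
Proof. by case: (lie_idealP J) => _ _; apply. Qed.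
Let JN x : ideal_set J x -> ideal_set J (- x).
Proof. by move=> Jx; rewrite -scaleN1r -[_ *: _]addr0; apply: Jlin. Qed.
Let JD x y : ideal_set J x -> ideal_set J y -> ideal_set J (x + y).
Proof. by move=> Jx Jy; rewrite -[x]scale1r; apply: Jlin. Qed.
Let JZ a x : ideal_set J x -> ideal_set J (a *: x).
Proof. by move=> Jx; rewrite -[_ *: _]addr0; apply: Jlin. Qed.

Lemma ideal_equiv_equiv : equiv_class_of ideal_equiv.
Proof.
split=> [x|x y|y x z].
- by apply/asboolP; rewrite subrr.
- by apply/idP/idP => /asboolP /JN; rewrite opprB => ?; apply/asboolP.
- move=> /asboolP Jxy /asboolP Jyz; apply/asboolP.
  by rewrite -(subrKA y); apply: JD.
Qed.

Canonical ideal_equiv_rel := EquivRelPack ideal_equiv_equiv.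

Definition lie_quot := {eq_quot ideal_equiv}.

HB.instance Definition _ := Choice.on lie_quot.

Definition lq_proj (x : L) : lie_quot := \pi_lie_quot x.
Definition lq_repr (x : lie_quot) : L := repr x.

Lemma lq_reprK x : lq_proj (lq_repr x) = x. Proof. exact: reprK. Qed.

Lemma lq_projP x y : lq_proj x = lq_proj y <-> ideal_set J (x - y).
Proof. by split=> [/eqmodP/asboolP|?] //; apply/eqmodP/asboolP. Qed.

Lemma lq_projK x : ideal_set J (lq_repr (lq_proj x) - x).
Proof. by apply/lq_projP; rewrite lq_reprK. Qed.

Definition lq_zero : lie_quot := lq_proj 0.
Definition lq_opp x : lie_quot := lq_proj (- lq_repr x).
Definition lq_add x y : lie_quot := lq_proj (lq_repr x + lq_repr y).
Definition lq_scale a x : lie_quot := lq_proj (a *: lq_repr x).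
Definition lq_lie x y : lie_quot := lq_proj (lie (lq_repr x) (lq_repr y)).

Lemma lq_projN x : lq_opp (lq_proj x) = lq_proj (- x).
Proof. by apply/lq_projP; rewrite -opprD; apply/JN/lq_projK. Qed.

Lemma lq_projD x y : lq_add (lq_proj x) (lq_proj y) = lq_proj (x + y).
Proof.
by apply/lq_projP; rewrite opprD addrACA; apply: JD; apply: lq_projK.
Qed.

Lemma lq_projZ a x : lq_scale a (lq_proj x) = lq_proj (a *: x).
Proof. by apply/lq_projP; rewrite -scalerBr; apply/JZ/lq_projK. Qed.

Lemma lq_proj_lie x y : lq_lie (lq_proj x) (lq_proj y) = lq_proj (lie x y).
Proof.
apply/lq_projP; set x' := lq_repr _; set y' := lq_repr _.
rewrite -(subrKA (lie x y')) -(lieNl x y') -(lieNr x y) -lieDl -lieDr lieC.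
by apply: JD; [apply: JN|]; apply: Jlie; apply: lq_projK.
Qed.

Let lqE := (lq_projN, lq_projD, lq_projZ, lq_proj_lie).

Lemma lq_addA : associative lq_add.
Proof.
by move=> x y z; rewrite -[x]lq_reprK -[y]lq_reprK -[z]lq_reprK !lqE addrA.
Qed.

Lemma lq_addC : commutative lq_add.
Proof. by move=> x y; rewrite -[x]lq_reprK -[y]lq_reprK !lqE addrC. Qed.

Lemma lq_add0 : left_id lq_zero lq_add.
Proof. by move=> x; rewrite -[x]lq_reprK !lqE add0r. Qed.

Lemma lq_addN : left_inverse lq_zero lq_opp lq_add.
Proof. by move=> x; rewrite -[x]lq_reprK !lqE addNr. Qed.

HB.instance Definition _ :=
  GRing.isZmodule.Build lie_quot lq_addA lq_addC lq_add0 lq_addN.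

Lemma lq_scaleA a b x : lq_scale a (lq_scale b x) = lq_scale (a * b) x.
Proof. by rewrite -[x]lq_reprK !lqE scalerA. Qed.

Lemma lq_scale1 : left_id 1 lq_scale.
Proof. by move=> x; rewrite -[x]lq_reprK !lqE scale1r. Qed.

Lemma lq_scaleDr : right_distributive lq_scale +%R.
Proof.
move=> a x y; rewrite -[x]lq_reprK -[y]lq_reprK.
by rewrite -[_ + _]/(lq_add _ _) -[RHS]/(lq_add _ _) !lqE scalerDr.
Qed.

Lemma lq_scaleDl x : {morph lq_scale^~ x : a b / a + b}.
Proof.
move=> a b; rewrite -[x]lq_reprK.
by rewrite -[RHS]/(lq_add _ _) !lqE scalerDl.
Qed.

HB.instance Definition _ := GRing.Zmodule_isLmodule.Build k lie_quot
  lq_scaleA lq_scale1 lq_scaleDr lq_scaleDl.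

Lemma lq_lie_linearl a x y z :
  lq_lie (a *: x + y) z = a *: lq_lie x z + lq_lie y z.
Proof.
rewrite -[x]lq_reprK -[y]lq_reprK -[z]lq_reprK.
rewrite -[_ + lq_proj _]/(lq_add (lq_scale _ _) _).
rewrite -[RHS]/(lq_add (lq_scale _ _) _).
by rewrite !lqE lie_linearl.
Qed.

Lemma lq_lie_linearr a x y z :
  lq_lie z (a *: x + y) = a *: lq_lie z x + lq_lie z y.
Proof.
rewrite -[x]lq_reprK -[y]lq_reprK -[z]lq_reprK.
rewrite -[_ + lq_proj _]/(lq_add (lq_scale _ _) _).
rewrite -[RHS]/(lq_add (lq_scale _ _) _).
by rewrite !lqE lie_linearr.
Qed.

Lemma lq_liexx x : lq_lie x x = 0.
Proof. by rewrite -[x]lq_reprK !lqE liexx. Qed.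

Lemma lq_lie_jacobi x y z :
  lq_lie x (lq_lie y z) + lq_lie y (lq_lie z x) + lq_lie z (lq_lie x y) = 0.
Proof.
rewrite -[x]lq_reprK -[y]lq_reprK -[z]lq_reprK.
by rewrite -[LHS]/(lq_add (lq_add _ _) _) !lqE lie_jacobi.
Qed.

HB.instance Definition _ := isLieAlgebra.Build k lie_quot
  lq_lie_linearl lq_lie_linearr lq_liexx lq_lie_jacobi.

End LieQuotient.

(* Lie(X) is the algebra of formal Lie expressions in X modulo the congruence
   generated by the axioms of Lie algebras over k; see [free_lie_universal]. *)

Section FreeLie.
Variables (k : fieldType) (X : Type).

Inductive lie_term :=
| LGen of X
| LZero
| LAdd of lie_term & lie_term
| LScale of k & lie_term
| LBr of lie_term & lie_term.

Inductive lie_eqv : lie_term -> lie_term -> Prop :=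
| LE_refl x : lie_eqv x x
| LE_sym x y : lie_eqv x y -> lie_eqv y x
| LE_trans x y z : lie_eqv x y -> lie_eqv y z -> lie_eqv x z
| LE_add x x' y y' :
    lie_eqv x x' -> lie_eqv y y' -> lie_eqv (LAdd x y) (LAdd x' y')
| LE_scale a x x' : lie_eqv x x' -> lie_eqv (LScale a x) (LScale a x')
| LE_br x x' y y' :
    lie_eqv x x' -> lie_eqv y y' -> lie_eqv (LBr x y) (LBr x' y')
| LE_addA x y z : lie_eqv (LAdd x (LAdd y z)) (LAdd (LAdd x y) z)
| LE_addC x y : lie_eqv (LAdd x y) (LAdd y x)
| LE_add0 x : lie_eqv (LAdd LZero x) x
| LE_addN x : lie_eqv (LAdd (LScale (-1) x) x) LZero
| LE_scaleA a b x : lie_eqv (LScale a (LScale b x)) (LScale (a * b) x)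
| LE_scale1 x : lie_eqv (LScale 1 x) x
| LE_scaleDr a x y :
    lie_eqv (LScale a (LAdd x y)) (LAdd (LScale a x) (LScale a y))
| LE_scaleDl a b x :
    lie_eqv (LScale (a + b) x) (LAdd (LScale a x) (LScale b x))
| LE_brl a x y z :
    lie_eqv (LBr (LAdd (LScale a x) y) z) (LAdd (LScale a (LBr x z)) (LBr y z))
| LE_brr a x y z :
    lie_eqv (LBr z (LAdd (LScale a x) y)) (LAdd (LScale a (LBr z x)) (LBr z y))
| LE_brxx x : lie_eqv (LBr x x) LZero
| LE_jacobi x y z :
    lie_eqv (LAdd (LAdd (LBr x (LBr y z)) (LBr y (LBr z x))) (LBr z (LBr x y)))
            LZero.

HB.instance Definition _ := gen_eqMixin lie_term.
HB.instance Definition _ := gen_choiceMixin lie_term.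

Definition lie_eqvb : rel lie_term := fun x y => `[< lie_eqv x y >].

Lemma lie_eqvb_equiv : equiv_class_of lie_eqvb.
Proof.
split=> [x|x y|y x z].
- exact/asboolP/LE_refl.
- by apply/idP/idP => /asboolP /LE_sym /asboolP.
- by move=> /asboolP xy /asboolP yz; apply/asboolP/(LE_trans xy yz).
Qed.

Canonical lie_eqvb_rel := EquivRelPack lie_eqvb_equiv.

Definition free_lie := {eq_quot lie_eqvb}.

HB.instance Definition _ := Choice.on free_lie.

Definition fl_proj (x : lie_term) : free_lie := \pi_free_lie x.
Definition fl_repr (x : free_lie) : lie_term := repr x.

Lemma fl_reprK x : fl_proj (fl_repr x) = x. Proof. exact: reprK. Qed.

Lemma fl_projP x y : fl_proj x = fl_proj y <-> lie_eqv x y.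
Proof. by split=> [/eqmodP/asboolP|?] //; apply/eqmodP/asboolP. Qed.

Lemma fl_projK x : lie_eqv (fl_repr (fl_proj x)) x.
Proof. by apply/fl_projP; rewrite fl_reprK. Qed.

Definition fl_zero : free_lie := fl_proj LZero.
Definition fl_opp x : free_lie := fl_proj (LScale (-1) (fl_repr x)).
Definition fl_add x y : free_lie := fl_proj (LAdd (fl_repr x) (fl_repr y)).
Definition fl_scale a x : free_lie := fl_proj (LScale a (fl_repr x)).
Definition fl_lie x y : free_lie := fl_proj (LBr (fl_repr x) (fl_repr y)).
Definition free_gen x : free_lie := fl_proj (LGen x).

Lemma fl_projN x : fl_opp (fl_proj x) = fl_proj (LScale (-1) x).
Proof. exact/fl_projP/LE_scale/fl_projK. Qed.

Lemma fl_projD x y : fl_add (fl_proj x) (fl_proj y) = fl_proj (LAdd x y).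
Proof. by apply/fl_projP/LE_add; apply: fl_projK. Qed.

Lemma fl_projZ a x : fl_scale a (fl_proj x) = fl_proj (LScale a x).
Proof. exact/fl_projP/LE_scale/fl_projK. Qed.

Lemma fl_proj_lie x y : fl_lie (fl_proj x) (fl_proj y) = fl_proj (LBr x y).
Proof. by apply/fl_projP/LE_br; apply: fl_projK. Qed.

Let flE := (fl_projN, fl_projD, fl_projZ, fl_proj_lie).

Lemma fl_addA : associative fl_add.
Proof.
move=> x y z; rewrite -[x]fl_reprK -[y]fl_reprK -[z]fl_reprK !flE.
exact/fl_projP/LE_addA.
Qed.

Lemma fl_addC : commutative fl_add.
Proof.
move=> x y; rewrite -[x]fl_reprK -[y]fl_reprK !flE.
exact/fl_projP/LE_addC.
Qed.

Lemma fl_add0 : left_id fl_zero fl_add.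
Proof. by move=> x; rewrite -[x]fl_reprK !flE; apply/fl_projP/LE_add0. Qed.

Lemma fl_addN : left_inverse fl_zero fl_opp fl_add.
Proof. by move=> x; rewrite -[x]fl_reprK !flE; apply/fl_projP/LE_addN. Qed.

HB.instance Definition _ :=
  GRing.isZmodule.Build free_lie fl_addA fl_addC fl_add0 fl_addN.

Lemma fl_scaleA a b x : fl_scale a (fl_scale b x) = fl_scale (a * b) x.
Proof. by rewrite -[x]fl_reprK !flE; apply/fl_projP/LE_scaleA. Qed.

Lemma fl_scale1 : left_id 1 fl_scale.
Proof. by move=> x; rewrite -[x]fl_reprK !flE; apply/fl_projP/LE_scale1. Qed.

Lemma fl_scaleDr : right_distributive fl_scale +%R.
Proof.
move=> a x y; rewrite -[x]fl_reprK -[y]fl_reprK.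
rewrite -[_ + _]/(fl_add _ _) -[RHS]/(fl_add _ _) !flE.
exact/fl_projP/LE_scaleDr.
Qed.

Lemma fl_scaleDl x : {morph fl_scale^~ x : a b / a + b}.
Proof.
move=> a b; rewrite -[x]fl_reprK -[RHS]/(fl_add _ _) !flE.
exact/fl_projP/LE_scaleDl.
Qed.

HB.instance Definition _ := GRing.Zmodule_isLmodule.Build k free_lie
  fl_scaleA fl_scale1 fl_scaleDr fl_scaleDl.

Lemma fl_lie_linearl a x y z :
  fl_lie (a *: x + y) z = a *: fl_lie x z + fl_lie y z.
Proof.
rewrite -[x]fl_reprK -[y]fl_reprK -[z]fl_reprK.
rewrite -[_ + fl_proj _]/(fl_add (fl_scale _ _) _).
rewrite -[RHS]/(fl_add (fl_scale _ _) _) !flE.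
exact/fl_projP/LE_brl.
Qed.

Lemma fl_lie_linearr a x y z :
  fl_lie z (a *: x + y) = a *: fl_lie z x + fl_lie z y.
Proof.
rewrite -[x]fl_reprK -[y]fl_reprK -[z]fl_reprK.
rewrite -[_ + fl_proj _]/(fl_add (fl_scale _ _) _).
rewrite -[RHS]/(fl_add (fl_scale _ _) _) !flE.
exact/fl_projP/LE_brr.
Qed.

Lemma fl_liexx x : fl_lie x x = 0.
Proof. by rewrite -[x]fl_reprK !flE; apply/fl_projP/LE_brxx. Qed.

Lemma fl_lie_jacobi x y z :
  fl_lie x (fl_lie y z) + fl_lie y (fl_lie z x) + fl_lie z (fl_lie x y) = 0.
Proof.
rewrite -[x]fl_reprK -[y]fl_reprK -[z]fl_reprK.
rewrite -[LHS]/(fl_add (fl_add _ _) _) !flE.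
exact/fl_projP/LE_jacobi.
Qed.

HB.instance Definition _ := isLieAlgebra.Build k free_lie
  fl_lie_linearl fl_lie_linearr fl_liexx fl_lie_jacobi.

Section Universal.
Variables (L : lieAlgType k) (h : X -> L).

Fixpoint lie_eval (t : lie_term) : L :=
  match t with
  | LGen x => h x
  | LZero => 0
  | LAdd x y => lie_eval x + lie_eval y
  | LScale a x => a *: lie_eval x
  | LBr x y => lie (lie_eval x) (lie_eval y)
  end.

Lemma lie_eval_eqv x y : lie_eqv x y -> lie_eval x = lie_eval y.
Proof.
elim=> {x y} //=; try by move=> *; congruence.
- by move=> *; rewrite addrA.
- by move=> x y; rewrite addrC.
- by move=> *; rewrite add0r.
- by move=> x; rewrite scaleN1r addNr.
- by move=> *; rewrite scalerA.
- by move=> *; rewrite scale1r.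
- by move=> *; rewrite scalerDr.
- by move=> *; rewrite scalerDl.
- by move=> *; rewrite lie_linearl.
- by move=> *; rewrite lie_linearr.
- by move=> *; rewrite liexx.
- by move=> *; rewrite lie_jacobi.
Qed.

Definition free_lift (x : free_lie) : L := lie_eval (fl_repr x).

Definition is_lie_morphism (phi : free_lie -> L) :=
  (forall a x y, phi (a *: x + y) = a *: phi x + phi y) /\
  (forall x y, phi (lie x y) = lie (phi x) (phi y)).

Lemma free_lie_universal :
  exists! phi : free_lie -> L,
    is_lie_morphism phi /\ forall x, phi (free_gen x) = h x.
Proof.
have fE x : free_lift (fl_proj x) = lie_eval x.
  exact/lie_eval_eqv/fl_projK.
exists free_lift; split=> [|phi [[phiD phiB] phiX]].
  split=> [|x]; last by rewrite fE.
  split=> [a x y|x y]; rewrite -[x]fl_reprK -[y]fl_reprK.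
    rewrite -[_ + fl_proj _]/(fl_add (fl_scale _ _) _) fl_projZ fl_projD.
    by rewrite !fE.
  by rewrite -[lie (fl_proj _) _]/(fl_lie _ _) fl_proj_lie !fE.
have phi0 : phi 0 = 0.
  by have := phiD (-1) 0 0; rewrite scaler0 addr0 scaleN1r addNr.
apply/funext => x; rewrite -[x]fl_reprK fE; elim: (fl_repr x) => //=.
- by move=> y; rewrite -phiX.
- move=> y IHy z IHz; rewrite -fl_projD IHy IHz.
  have := phiD 1 (fl_proj y) (fl_proj z).
  by rewrite !scale1r => <-.
- move=> a y IHy; rewrite -fl_projZ IHy.
  have := phiD a (fl_proj y) 0.
  by rewrite phi0 !addr0 => <-.
- by move=> y IHy z IHz; rewrite -fl_proj_lie IHy IHz -phiB.
Qed.

End Universal.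
End FreeLie.

Section Metabelian.
Variables (k : fieldType) (d : Order.disp_t) (X : orderType d).

Definition free_metab := lie_quot (derived_lie_ideal (free_lie k X) 2).

HB.instance Definition _ := LieAlgebra.on free_metab.

Notation L2 := free_metab.

Definition gen (x : X) : L2 := lq_proj _ (free_gen k x).

Definition lnprod (f : L2) (s : seq X) : L2 :=
  foldl (fun g a => lie g (gen a)) f s.

(* A word a0 a1 ... an of N is represented by the sequence of its letters. *)
Definition in_R (w : seq X) : bool :=
  if w is a0 :: a1 :: t then (a1 < a0)%O && sorted <=%O (a1 :: t) else false.

Definition in_N (w : seq X) : bool := (size w == 1)%N || in_R w.

(* The element of the algebra denoted by a word; only used for w \in N. *)
Definition word (w : seq X) : L2 :=
  if w is a0 :: s then lnprod (gen a0) s else 0.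

Definition word_lt (u v : seq X) : bool :=
  (size u < size v)%N || ((size u == size v) && (u < v :> seqlexi X)%O).

Definition is_expansion (f : L2) (c : {fsfun seq X -> k with 0}) :=
  {subset finsupp c <= in_N} /\ f = \sum_(w <- finsupp c) c w *: word w.

(* The coordinates of f in the basis N; the default value of xget is
   irrelevant, since N is a basis. *)
Definition expansion (f : L2) : {fsfun seq X -> k with 0} :=
  xget [fsfun] [set c | is_expansion f c].

Definition coef (f : L2) (w : seq X) : k := expansion f w.

Definition part1 (f : L2) : L2 :=
  \sum_(w <- finsupp (expansion f) | in_R w) coef f w *: word w.

Definition part0 (f : L2) : L2 :=
  \sum_(w <- finsupp (expansion f) | size w == 1%N) coef f w *: word w.

(* [lead f w] says that f is nonzero and that w is its leading word. *)
Definition lead (f : L2) (w : seq X) : Prop :=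
  coef f w != 0 /\ forall v, coef f v != 0 -> v != w -> word_lt v w.

Definition monic (f : L2) : Prop := exists2 w, lead f w & coef f w = 1.

Inductive normal_word (S : set L2) : L2 -> Prop :=
| Normal_left s ws t of
    S s & lead s ws & sorted <=%O t &
    (forall a1 t', t = a1 :: t' -> ws <> [:: a1]) :
    normal_word S (lnprod s t)
| Normal_right u s ws of
    in_R u & S s & lead s ws & ws <> u :
    normal_word S (lie (word u) s).

Definition trivial_mod (S : set L2) (w : seq X) (f : L2) : Prop :=
  lspan [set u | normal_word S u /\ exists2 wu, lead u wu & word_lt wu w] f.

(* < a_1 ... a_m > : the letters in non-decreasing order.  The free commutative
   monoid [X] is {mset X}, where msetU is the least common multiple and msetB
   the quotient. *)
Definition ord_letters (s : seq X) : seq X := sort <=%O s.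

Definition omit_nth (i : nat) (s : seq X) : seq X := take i s ++ drop i.+1 s.

(* [composition f g w C] says that C is a composition C_lambda(f, g)_w, for
   monic f and g.  A word a0 a1 ... an is written a0 :: s, hence in type II the
   letter a_i, i >= 1, is the entry of index j = i - 1 in s.  The conditions
   "lead f w" and "lead (part1 f) w" together state that the leading words of f
   and of f^(1) are both equal to w. *)
Inductive composition (f g : L2) : seq X -> L2 -> Prop :=
| Comp_I a0 s t of
    lead f (a0 :: s) & lead g (a0 :: t) :
    let F := seq_mset s in let G := seq_mset t in let M := msetU F G in
    composition f g (a0 :: ord_letters M)
      (lnprod f (ord_letters (msetB M F)) - lnprod g (ord_letters (msetB M G)))
| Comp_II a0 s j b of
    lead f (a0 :: s) & lead (part1 f) (a0 :: s) &
    (j < size s)%N & nth a0 s j = b & lead (part0 g) [:: b] &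
    ((0 < j)%N \/ exists a1 a2 t, s = [:: a1, a2 & t] /\ (a2 < a0)%O) :
    composition f g (a0 :: s)
      (f - (coef g [:: b])^-1 *: lie (word (a0 :: omit_nth j s)) g)
| Comp_III a0 a1 t of
    lead f [:: a0, a1 & t] & lead (part1 f) [:: a0, a1 & t] &
    lead g [:: a1] & lead (part0 g) [:: a1] &
    (forall a2 t', t = a2 :: t' -> (a0 <= a2)%O) :
    composition f g [:: a0, a1 & t] (f + lnprod g (a0 :: t))
| Comp_IV a0 a1 t a of
    lead f [:: a0, a1 & t] & lead (part1 f) [:: a0, a1 & t] &
    part1 g != 0 & lead (part0 g) [:: a1] &
    (forall a2 t', t = a2 :: t' -> (a0 <= a2)%O) &
    (a < a0)%O :
    composition f g (a0 :: ord_letters (rcons (a1 :: t) a))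
      (lie f (gen a) - (coef g [:: a1])^-1 *: lie (word [:: a0, a & t]) g)
| Comp_V a0 s b of
    lead f (a0 :: s) & lead (part1 f) (a0 :: s) &
    part0 f != 0 & part1 g != 0 & lead (part0 g) [:: b] & b \notin s :
    composition f g (a0 :: ord_letters (rcons s b))
      (lie f (gen b) - (coef g [:: b])^-1 *: lie (word (a0 :: s)) g)
| Comp_VI a a0 a1 of
    lead (part0 f) [:: a] & lead (part0 g) [:: a] & part1 f != 0 &
    in_R [:: a0; a1] :
    composition f g (a0 :: ord_letters [:: a1; a])
      (lie (word [:: a0; a1])
           ((coef f [:: a])^-1 *: f - (coef g [:: a])^-1 *: g))
| Comp_VII a b a0 of
    part1 f != 0 & part1 g != 0 &
    lead (part0 f) [:: a] & lead (part0 g) [:: b] & (b < a)%O & (a < a0)%O :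
    composition f g [:: a0; b; a]
      ((coef f [:: a])^-1 *: lie (word [:: a0; b]) f -
       (coef g [:: b])^-1 *: lie (word [:: a0; a]) g).

Definition is_GS_basis (S : set L2) : Prop :=
  (forall f, S f -> monic f) /\
  (forall f g w C, S f -> S g -> composition f g w C -> trivial_mod S w C).

(* S is a Groebner-Shirshov basis for L_(2)(X | T) = L_(2)(X) / Id(T). *)
Definition is_GS_basis_for (S T : set L2) : Prop :=
  is_GS_basis S /\ ideal_gen S = ideal_gen T.

End Metabelian.

Section Trees.
Variables (V : choiceType) (adj : rel V).

(* A graph is given by its adjacency relation; a circuit is a closed path
   through at least three distinct vertices, circuits of length 1 and 2 being
   excluded by the use of a simple graph. *)
Definition is_tree : Prop :=
  [/\ symmetric adj, irreflexive adj, inhabited V,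
      forall u v, exists2 p, path adj u p & last u p = v
    & forall c, (2 < size c)%N -> ~ ucycle adj c].

Fixpoint no_backtrack (s : seq V) : bool :=
  if s is x :: s' then
    (if s' is _ :: z :: _ then x != z else true) && no_backtrack s'
  else true.

(* The path from u to v without backtracking is unique in a tree, so xget
   returns its length. *)
Definition tree_dist (u v : V) : nat :=
  xget 0%N [set n | exists p, [/\ path adj u p, last u p = v,
                                  no_backtrack (u :: p) & size p = n]].

Definition level (v0 : V) (n : nat) : set V := [set v | tree_dist v0 v = n].

End Trees.

Section TreeRelations.
Variables (k : fieldType) (d : Order.disp_t) (V : orderType d).

Definition tree_relations (adj : rel V) (v0 : V) : set (free_metab k V) :=
  [set f | exists n v' v, [/\ level adj v0 n.+1 v', level adj v0 n v,
                              adj v' v & f = lie (gen k v') (gen k v)]].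

End TreeRelations.

Arguments tree_relations k {d V} adj v0.

(* Main.v *)
(* Every relation [v', v] with v' > v is itself a word of R with zero linear
   part, so only compositions of type I can occur, between relations [v', v] and
   [v', u] with u and v both adjacent to v' and one step closer to the root.  In
   a tree u = v, and the composition is identically 0.  Reading off the leading
   words requires the words of N to be linearly independent: under the Magnus
   embedding x |-> x + e_x into k X |x (+)_x e_x k[X], the word a0 a1 ... an goes
   to e_a0 a1 a2 ... an - e_a1 a0 a2 ... an, and only its first term has the form
   e_b m with b greater than the smallest letter of m. *)

Require Import Defs.
From HB Require Import structures.
From mathcomp Require Import all_boot all_order all_algebra.
From mathcomp Require Import finmap ring monalg.
From mathcomp Require Import boolp classical_sets.

Set Implicit Arguments.
Unset Strict Implicit.
Unset Printing Implicit Defensive.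

Import Order.TTheory GRing.Theory.
Local Open Scope ring_scope.

(** * Walks without backtracking in a tree *)

Section TreeWalks.
Variables (V : choiceType) (adj : rel V).
Hypothesis tree_adj : is_tree adj.
Implicit Types (u v x y : V) (p q s : seq V).

(** Stating the condition with [ohead] avoids a case split on [s] and matches the conclusion of
    [diverging_walks]. *)
Lemma no_backtrack_cons x y s :
  no_backtrack (x :: y :: s) = (ohead s != Some x) && no_backtrack (y :: s).
Proof. by case: s => //= z s; rewrite (inj_eq Some_inj) eq_sym. Qed.

Lemma no_backtrack_catl s q : no_backtrack (s ++ q) -> no_backtrack s.
Proof.
elim: s => //= x s IHs /andP[xs /IHs ->]; rewrite andbT.
by case: s {IHs} xs => [|y [|z s]].
Qed.

Lemma no_backtrack_rcons x s y z :
  no_backtrack (rcons (x :: s) y) -> last x s != z ->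
  no_backtrack (rcons (rcons (x :: s) y) z).
Proof.
elim: s x => [x _|x' s IHs x]; first by rewrite /= => ->.
rewrite !rcons_cons !no_backtrack_cons => /andP[xs nbs] lastz.
by rewrite -!rcons_cons IHs // andbT; case: s {IHs nbs lastz} xs.
Qed.

Lemma uniq_no_backtrack s : uniq s -> no_backtrack s.
Proof.
elim: s => //= x s IHs /andP[xs /IHs ->]; rewrite andbT.
by case: s xs {IHs} => [|y [|z s]] //; rewrite !inE !negb_or; case/and3P.
Qed.

(** By induction only [u] can recur. The piece up to its return would be a circuit: length 1 is
    excluded by irreflexivity, length 2 by the absence of backtracking. *)
Lemma no_backtrack_uniq u p :
  path adj u p -> no_backtrack (u :: p) -> uniq (u :: p).
Proof.
case: tree_adj => _ irr _ _ nocirc.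
elim: p u => [//|x p IHp] u adjp nbp.
have {IHp} : uniq (x :: p).
  by apply: IHp; [case/andP: adjp | case/andP: nbp].
rewrite [uniq (u :: _)]cons_uniq => uniqp; rewrite uniqp andbT.
apply/negP => up; case/splitPr: up adjp nbp uniqp => p1 p2.
rewrite -cat_rcons cat_path cat_uniq => /andP[adjp1 _] nbp /andP[uniqp1 _].
apply: (nocirc (rcons p1 u)); last first.
  apply/andP; split=> //; case: p1 adjp1 {nbp uniqp1} => /= [|y p1].
    by rewrite andbT.
  by case/andP=> uy adjp1; rewrite rcons_path adjp1 last_rcons.
case: p1 adjp1 nbp {uniqp1} => [|y [|z p1]] /=; rewrite ?irr //.
  by rewrite eqxx.
by rewrite size_rcons.
Qed.

(** Suppose [p] starts with [x] and [q] does not. Then [u :: q] is a walk from [x] to [v] without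
    backtracking, so by induction the rest of [p] starts with [u], and the first walk backtracks at
    once. *)
Lemma diverging_walks u v p q :
  path adj u p -> path adj u q -> last u p = v -> last u q = v ->
  no_backtrack (u :: p) -> no_backtrack (u :: q) -> ohead p = ohead q.
Proof.
case: (tree_adj) => sym _ _ _ _.
have closed w s : path adj w s -> last w s = w -> no_backtrack (w :: s) ->
    s = [::].
  move=> adjs lasts /(no_backtrack_uniq adjs) /=.
  by case: s lasts {adjs} => //= x s <-; rewrite mem_last.
elim: p u q => [|x p IHp] u q adjp adjq lastp lastq nbp nbq.
  by rewrite (closed u q) ?lastq // -lastp.
apply/eqP/negPn/negP => neq; case/andP: adjp => ux adjp.
move: nbp; rewrite no_backtrack_cons => /andP[/negP nbu nbp].
apply/nbu/eqP; apply: (IHp x (u :: q)) => //.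
  by rewrite /= sym ux.
by rewrite no_backtrack_cons nbq eq_sym neq.
Qed.

Lemma no_backtrack_unique u v p q :
  path adj u p -> path adj u q -> last u p = v -> last u q = v ->
  no_backtrack (u :: p) -> no_backtrack (u :: q) -> p = q.
Proof.
elim: p u q => [|x p IHp] u q adjp adjq lastp lastq nbp nbq;
  have := diverging_walks adjp adjq lastp lastq nbp nbq;
  case: q adjq lastq nbq => //= y q.
move=> /andP[_ adjq] lastq nbq [xy]; rewrite -xy in adjq lastq nbq *.
case/andP: adjp nbp => _ adjp /andP[_ nbp]; case/andP: nbq => _ nbq.
by rewrite (IHp x q).
Qed.

Lemma tree_distE u v p :
  path adj u p -> last u p = v -> no_backtrack (u :: p) ->
  tree_dist adj u v = size p.
Proof.
move=> adjp lastp nbp; apply: xget_subset1; first by exists p.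
move=> _ _ [p1 [? ? ? <-]] [p2 [? ? ? <-]].
by rewrite (@no_backtrack_unique u v p1 p2).
Qed.

Lemma tree_distP u v : exists p,
  [/\ path adj u p, last u p = v, no_backtrack (u :: p)
    & size p = tree_dist adj u v].
Proof.
case: (tree_adj) => _ _ _ conn _; have [p adjp lastp] := conn u v.
(* Shortening the walk to distinct vertices removes all backtracking. *)
case/shortenP: adjp lastp => q adjq uniqq _ lastq.
exists q; split=> //; first exact: uniq_no_backtrack.
by rewrite (tree_distE adjq lastq) // uniq_no_backtrack.
Qed.

(** The walk from [v0] to a neighbour of [w] one step closer to [v0] can be continued to [w] without
    backtracking. Only one such walk ends in [w], so its last vertex but one is determined. *)
Lemma level_parent_unique v0 n w u v :
  level adj v0 n.+1 w -> level adj v0 n u -> level adj v0 n v ->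
  adj w u -> adj w v -> u = v.
Proof.
case: (tree_adj) => sym _ _ _ _ lw.
suff walk x : level adj v0 n x -> adj w x -> exists p,
    [/\ path adj v0 (rcons p w), no_backtrack (v0 :: rcons p w)
      & last v0 p = x].
  move=> lu lv wu wv; have [p [adjp nbp <-]] := walk u lu wu.
  have [q [adjq nbq <-]] := walk v lv wv.
  have /rcons_inj[->//] : rcons p w = rcons q w.
  by apply: (no_backtrack_unique adjp adjq _ _ nbp nbq); rewrite last_rcons.
move=> lx wx; have [p [adjp lastp nbp szp]] := tree_distP v0 x.
exists p; split=> //; first by rewrite rcons_path adjp lastp sym.
case/lastP: p => [|p y] in adjp lastp nbp szp * => //.
rewrite last_rcons in lastp; rewrite {y}lastp in adjp nbp szp *.
rewrite -!rcons_cons; apply: no_backtrack_rcons => //; apply/eqP => lastw.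
(* A walk backtracking at its last step passes through w at distance n - 1. *)
move: adjp nbp; rewrite rcons_path -rcons_cons -cats1.
move=> /andP[adjp _] /no_backtrack_catl nbp.
have := tree_distE adjp lastw nbp.
by rewrite lw -lx -szp size_rcons => /eqP; rewrite gtn_eqF.
Qed.

End TreeWalks.

(** * Morphisms from the free metabelian Lie algebra, and a target for them *)

Lemma free_metab_lift (k : fieldType) (d : Order.disp_t) (X : orderType d)
    (L : lieAlgType k) (h : X -> L) :
    (forall x : L, derived 2 x -> x = 0) ->
  exists psi : free_metab k X -> L,
    [/\ forall a x y, psi (a *: x + y) = a *: psi x + psi y,
        forall x y, psi (lie x y) = lie (psi x) (psi y)
      & forall x, psi (gen k x) = h x].
Proof.
move=> metabL; have [phi [[[phiP phi_lie] phiX] _]] := free_lie_universal h.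
have phi0 : phi 0 = 0.
  by have := phiP (-1) 0 0; rewrite scaler0 addr0 scaleN1r addNr.
(* Morphisms respect the derived series, so [phi] kills the second derived ideal and its value on a
   class does not depend on the representative. *)
have phi_der n x : derived n x -> derived n (phi x).
  elim: n x => //= n IHn _ [s [sd ->]]; elim: s sd => [|p s IHs] sd.
    by rewrite big_nil phi0; apply: lspan0.
  have ps q : q \in s -> q \in p :: s by rewrite inE orbC => ->.
  rewrite big_cons phiP; apply: lspan_lin; last by apply: IHs => q /ps /sd.
  have [a da [b db <-]] := sd p (mem_head _ _).
  by rewrite phi_lie; apply: sub_lspan; exists (phi a); [|exists (phi b)]; auto.
pose psi (x : free_metab k X) := phi (lq_repr x).
have psi_proj x : psi (lq_proj _ x) = phi x.
  have /phi_der/metabL := lq_projK (derived_lie_ideal (free_lie k X) 2) x.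
  by rewrite -scaleN1r addrC phiP scaleN1r addrC => /subr0_eq.
exists psi; split=> [a x y|x y|x]; last by rewrite psi_proj phiX.
  rewrite -[x]lq_reprK -[y]lq_reprK -[_ + _]/(lq_add (lq_scale _ _) _).
  by rewrite lq_projZ lq_projD !psi_proj.
rewrite -[x]lq_reprK -[y]lq_reprK -[X in psi X]/(lq_lie _ _).
by rewrite lq_proj_lie !psi_proj.
Qed.

(* With A acting on itself by multiplication: A |x A, where both copies of A
   are abelian. *)
Definition semidirect (k : fieldType) (A : comAlgType k) : Type := (A * A)%type.

Section Semidirect.
Variables (k : fieldType) (A : comAlgType k).
Notation L := (semidirect A).

HB.instance Definition _ := GRing.Lmodule.copy L (A * A)%type.

(** The first component acts on the second from the right: the bracket of (0, m) with (p, 0) is (0,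
    m p), so that left-normed products turn into products in [A]. *)
Definition sd_lie (x y : L) : L := (0, x.2 * y.1 - y.2 * x.1).

Lemma sd_lie_linearl a x y z :
  sd_lie (a *: x + y) z = a *: sd_lie x z + sd_lie y z.
Proof.
congr pair => /=; first by rewrite scaler0 addr0.
by rewrite scalerBr !mulrDl !mulrDr -!scalerAl -!scalerAr opprD addrACA.
Qed.

Lemma sd_liexx x : sd_lie x x = 0.
Proof. by congr pair; rewrite /= subrr. Qed.

Lemma sd_lie_linearr a x y z :
  sd_lie z (a *: x + y) = a *: sd_lie z x + sd_lie z y.
Proof.
congr pair => /=; first by rewrite scaler0 addr0.
by rewrite scalerBr !mulrDl !mulrDr -!scalerAl -!scalerAr opprD addrACA.
Qed.

Lemma sd_lie_jacobi x y z :
  sd_lie x (sd_lie y z) + sd_lie y (sd_lie z x) + sd_lie z (sd_lie x y) = 0.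
Proof. by congr pair => /=; ring. Qed.

HB.instance Definition _ := isLieAlgebra.Build k L
  sd_lie_linearl sd_lie_linearr sd_liexx sd_lie_jacobi.

Lemma sd_metabelian (x : L) : derived 2 x -> x = 0.
Proof.
have der1 (y : L) : derived 1 y -> y.1 = 0.
  case=> s [sd ->]; rewrite (raddf_sum fst) big_seq big1 // => p.
  by case/sd=> a _ [b _ <-]; apply: scaler0.
case=> s [sd ->]; rewrite big_seq big1 // => p /sd[a /der1 a0 [b /der1 b0 <-]].
by rewrite -[lie a b]/(sd_lie a b) /sd_lie a0 b0 !mulr0 subrr scaler0.
Qed.

End Semidirect.

(** * Monomials in the polynomial ring k[X] *)

Lemma malgU_prod (K : conomType) (R : comNzRingType) (T : Type) (s : seq T)
    (F : T -> K) :
  \prod_(a <- s) << F a >> = << \big[mmul/mone]_(a <- s) F a >> :> {malg R[K]}.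
Proof.
elim: s => [|a s IHs]; first by rewrite !big_nil.
by rewrite !big_cons IHs malgM_def fgmulUU mulr1.
Qed.

Lemma cmonom_prod_eq (X : choiceType) (s t : seq X) :
  (\big[mmul/mone]_(a <- s) ucm a == \big[mmul/mone]_(a <- t) ucm a)
    = perm_eq s t.
Proof.
have countE (r : seq X) b : (\big[mmul/mone]_(a <- r) ucm a) b = count_mem b r.
  elim: r => [|a r IHr]; first by rewrite big_nil cm1.
  by rewrite big_cons cmM IHr cmU.
apply/eqP/idP => [eqst|/permP eqst].
  by apply/allP => a _; rewrite /= -!countE eqst.
by apply/eqP/cmP => a; rewrite !countE eqst.
Qed.

(** This is the interface to k[X] used below: [cf] extracts the coefficient of the monomial with
    letters [r], whatever their order. *)
Lemma polynomial_ring (k : fieldType) (X : choiceType) :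
  exists (P : comAlgType k) (var : X -> P), forall r, exists2 cf : P -> k,
    forall c f g, cf (c *: f + g) = c * cf f + cf g
  & forall s, cf (\prod_(a <- s) var a) = (perm_eq s r)%:R.
Proof.
exists {malg k[{cmonom X}]}, (fun a => << ucm a >>) => r.
exists (mcoeff (\big[mmul/mone]_(a <- r) ucm a)) => [c f g|s].
  by rewrite mcoeffD mcoeffZ.
by rewrite malgU_prod mcoeffU1 cmonom_prod_eq.
Qed.

(** * Linear independence of the words of N, and coordinates *)

Section Coordinates.
Variables (k : fieldType) (d : Order.disp_t) (X : orderType d).
Implicit Types (a b : X) (r s t v w : seq X).

Lemma in_R_in_N w : in_R w -> in_N w.
Proof. by move=> Rw; rewrite /in_N Rw orbT. Qed.

(** The two parts match e_a0 s against the two Magnus terms of b0 b1 t. A sorted tail is determined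
    by its multiset of letters. In the second part a1 < a0 = b1 would be a letter of b0 t, but none
    of these is below b1. *)
Lemma in_R_perm a0 s b0 b1 t :
  in_R (a0 :: s) -> in_R [:: b0, b1 & t] ->
  (b0 == a0) && perm_eq (b1 :: t) s = ([:: b0, b1 & t] == a0 :: s)
  /\ (b1 == a0) && perm_eq (b0 :: t) s = false.
Proof.
case: s => // a1 s /andP[a10 srt_a] /andP[b10 srt_b]; split.
  rewrite eqseq_cons; congr (_ && _).
  by apply/idP/eqP => [/(sorted_eq le_trans le_anti)->|-> //].
apply/negP => /andP[/eqP b1a0 eqbs].
have : a1 \in b0 :: t by rewrite (perm_mem eqbs) mem_head.
have b1_min x : x \in b0 :: t -> (b1 <= x)%O.
  rewrite inE => /predU1P[->|]; first exact: ltW.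
  by move: srt_b; rewrite /= (path_sortedE le_trans) => /andP[/allP + _]; apply.
by move/b1_min; rewrite b1a0 leNgt a10.
Qed.

(* The a-component of the Magnus embedding of the free metabelian Lie algebra
   in a free module over the polynomial ring: each generator x goes to
   x + e_x, and only the coordinate on e_a of the module is kept. *)
Lemma magnus_component (P : comAlgType k) (var : X -> P) a :
  exists psi : free_metab k X -> P * P,
  [/\ forall c f g, psi (c *: f + g) = c *: psi f + psi g,
      forall b, psi (word k [:: b]) = (var b, (b == a)%:R)
    & forall b0 b1 t, psi (word k [:: b0, b1 & t]) =
        (0, (b0 == a)%:R * \prod_(b <- b1 :: t) var b
            - (b1 == a)%:R * \prod_(b <- b0 :: t) var b)].
Proof.
have [psi [psiP psi_lie psiX]] := free_metab_lift
  (fun x => (var x, (x == a)%:R) : semidirect P) (@sd_metabelian k P).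
exists psi; split=> // b0 b1 t.
have -> : word k [:: b0, b1 & t] = lnprod (lie (gen k b0) (gen k b1)) t by [].
(* Once the first component vanishes, bracketing with a generator only multiplies the second one by
   its variable. *)
have lnE f : (psi f).1 = 0 ->
    psi (lnprod f t) = (0, (psi f).2 * \prod_(b <- t) var b).
  elim: t f => [|b t IHt] f f0.
    by rewrite big_nil mulr1 -f0; case: (psi f).
  have psi_fb : psi (lie f (gen k b)) = (0, (psi f).2 * var b).
    by rewrite psi_lie psiX; congr pair; rewrite /= f0 mulr0 subr0.
  by rewrite /= IHt psi_fb // big_cons mulrA.
rewrite lnE psi_lie !psiX //=; congr pair.
by rewrite !big_cons mulrBl !mulrA.
Qed.

(** A letter is detected in the first component, which vanishes on longer words. A longer word a r
    is detected by the coefficient of the monomial r in the e_a coordinate, where letters contribute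
    only constants. *)
Lemma dual_word w : in_N w ->
  exists2 phi : free_metab k X -> k,
    forall c f g, phi (c *: f + g) = c * phi f + phi g
  & forall v, in_N v -> phi (word k v) = (v == w)%:R.
Proof.
have [P [var varP]] := polynomial_ring k X.
case: w => [//|a r] Nw; have [psi [psiP psi1 psi2]] := magnus_component var a.
have [cf cfP cfE] := varP (if r is [::] then [:: a] else r).
have cf0 : cf 0 = 0.
  by have := cfP (-1) 0 0; rewrite scaler0 addr0 mulN1r addNr.
have cfB f g : cf (f - g) = cf f - cf g.
  by rewrite addrC -scaleN1r cfP mulN1r addrC.
have cf_bool (e : bool) s :
    cf (e%:R * \prod_(b <- s) var b) =
    (e && perm_eq s (if r is [::] then [:: a] else r))%:R.
  by case: e; rewrite ?mul1r ?cfE // mul0r cf0.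
case: r Nw {varP cfE} cf_bool => [_|a1 r Nw] cf_bool.
  exists (fun f => cf (psi f).1) => [c f g|v]; first by rewrite psiP -cfP.
  case: v => [//|b [|b1 t]] Nv; last by rewrite psi2 cf0 eqseq_cons andbF.
  have := cf_bool true [:: b]; rewrite psi1 mul1r big_seq1 => -> /=.
  have <- // : perm_eq [:: b] [:: a] = ([:: b] == [:: a]).
  by apply/idP/eqP => [/perm_small_eq ->|->].
exists (fun f => cf (psi f).2) => [c f g|v]; first by rewrite psiP -cfP.
case: v => [//|b [|b1 t]] Nv.
  have := cf_bool (b == a) [::]; rewrite psi1 big_nil mulr1 => ->.
  have -> : perm_eq [::] (a1 :: r) = false by apply/negP => /perm_size.
  by rewrite eqseq_cons !andbF.
rewrite psi2 cfB !cf_bool; have [-> ->] := in_R_perm Nw Nv.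
by rewrite subr0.
Qed.

(** On N each coefficient is the value at [f] of a dual functional; outside N it is the default
    0. *)
Lemma expansion_unique (f : free_metab k X) c c' :
  is_expansion f c -> is_expansion f c' -> c = c'.
Proof.
suff coefE e w : is_expansion f e -> in_N w -> forall phi : free_metab k X -> k,
    (forall c f g, phi (c *: f + g) = c * phi f + phi g) ->
    (forall v, in_N v -> phi (word k v) = (v == w)%:R) -> e w = phi f.
  move=> exp_c exp_c'; apply/fsfunP => w; have [Nw|nNw] := boolP (in_N w).
    have [phi phiP phiE] := dual_word Nw.
    by rewrite (coefE _ _ exp_c Nw _ phiP phiE) (coefE _ _ exp_c' Nw _ phiP phiE).
  case: exp_c exp_c' => [sc _] [sc' _]; rewrite !fsfun_dflt //.
    by apply: contra nNw => /sc'.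
  by apply: contra nNw => /sc.
move=> [se ->] Nw phi phiP phiE.
have phi0 : phi 0 = 0.
  by have := phiP (-1) 0 0; rewrite scaler0 addr0 mulN1r addNr.
have -> : phi (\sum_(v <- finsupp e) e v *: word k v) =
    \sum_(v <- finsupp e) e v * (v == w)%:R.
  elim: (enum_fset _) {se}(se : {in enum_fset (finsupp e), forall v, in_N v})
    => [|v s IHs] Ns; first by rewrite !big_nil.
  have vs u : u \in s -> u \in v :: s by rewrite inE orbC => ->.
  by rewrite !big_cons phiP phiE ?Ns ?mem_head // IHs // => u /vs /Ns.
have [we|we] := boolP (w \in finsupp e).
  rewrite (big_fsetD1 w) //= eqxx mulr1 big1_fset ?addr0 // => v.
  by rewrite !inE => /andP[/negPf-> _]; rewrite mulr0.
rewrite fsfun_dflt // big_seq big1 // => v ve.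
by case: eqP => [vw|_]; rewrite ?mulr0 //; case/negP: we; rewrite -vw.
Qed.

Lemma expansionE (f : free_metab k X) c : is_expansion f c -> expansion f = c.
Proof.
by move=> exp_c; apply: xget_subset1 => // ? ?; apply: expansion_unique.
Qed.

Lemma expansion0 : expansion (0 : free_metab k X) = [fsfun].
Proof.
by apply: expansionE; split=> [v|]; rewrite finsupp0 ?inE ?big_seq_fset0.
Qed.

Definition unit_coords w : {fsfun seq X -> k with 0} :=
  [fsfun [fsfun] with w |-> 1]%fsfun.

Lemma unit_coordsE w v : unit_coords w v = (v == w)%:R.
Proof. by rewrite fsfun_withE fsfun0E; case: eqP. Qed.

Lemma finsupp_unit_coords w : finsupp (unit_coords w) = [fset w]%fset.
Proof. by rewrite finsupp_with /= oner_eq0 finsupp0 fsetU0. Qed.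

Lemma is_expansion_word w : in_N w ->
  is_expansion (word k w) (unit_coords w).
Proof.
move=> Nw; split=> [v|]; rewrite finsupp_unit_coords.
  by rewrite inE => /eqP->.
by rewrite big_seq_fset1 unit_coordsE eqxx scale1r.
Qed.

Lemma coef_word w v : in_N w -> coef (word k w) v = (v == w)%:R.
Proof.
by move=> Nw; rewrite /coef (expansionE (is_expansion_word Nw)) unit_coordsE.
Qed.

Lemma lead_word w v : in_N w -> lead (word k w) v <-> v = w.
Proof.
move=> Nw; rewrite /lead; split=> [[]|->].
  by rewrite coef_word //; case: (v =P w); rewrite ?eqxx.
rewrite coef_word // eqxx oner_neq0; split=> // u; rewrite coef_word //.
by case: (u == w) => //; rewrite mulr0n eqxx.
Qed.

Lemma monic_word w : in_N w -> Defs.monic (word k w).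
Proof.
by move=> Nw; exists w; [apply/lead_word | rewrite coef_word // eqxx].
Qed.

Lemma part0_word w : in_R w -> part0 (word k w) = 0.
Proof.
move=> Rw; have Nw := in_R_in_N Rw.
rewrite /part0 (expansionE (is_expansion_word Nw)) big_seq_cond big1 // => v.
rewrite finsupp_unit_coords inE => /andP[/eqP-> sz1].
by case: w Rw sz1 {Nw} => [|? []].
Qed.

Lemma lead0 w : ~ lead (0 : free_metab k X) w.
Proof. by rewrite /lead /coef expansion0 fsfun0E eqxx => -[]. Qed.

End Coordinates.

Theorem theorem3p7 (k : fieldType) (d : Order.disp_t) (V : orderType d)
    (adj : rel V) (v0 : V)
    (tree_adj : is_tree adj)
    (wf_V : well_founded (fun v v' : V => (v < v')%O))
    (v0_min : forall v : V, (v0 <= v)%O)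
    (level_lt : forall (i j : nat) (v v' : V),
        level adj v0 i v -> level adj v0 j v' -> (i < j)%N -> (v < v')%O) :
  is_GS_basis_for (tree_relations k adj v0) (tree_relations k adj v0).
Proof.
split=> //.
have relP f : tree_relations k adj v0 f -> exists w v,
    [/\ f = word k [:: w; v], in_R [:: w; v]
      & exists2 n, level adj v0 n.+1 w & level adj v0 n v /\ adj w v].
  move=> [n [w [v [lw lv wv ->]]]]; exists w, v; split=> //; last by exists n.
  by rewrite /= andbT; apply: level_lt lv lw _.
have part0_rel f w : tree_relations k adj v0 f -> ~ lead (part0 f) w.
  by move=> /relP[? [? [-> Rf _]]]; rewrite part0_word //; apply: lead0.
split=> [f /relP[w [v [-> /in_R_in_N Nf _]]]|f g w C Sf Sg].
  exact: monic_word.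
(* Types II-VII all require the linear part of g to be nonzero. *)
case; try by [move=> *; exfalso; apply: part0_rel Sg _; eassumption].
move=> a0 s t; case/relP: Sf => w1 [v1 [-> Rf [n lw1 [lv1 adj1]]]].
case/relP: Sg => w2 [v2 [-> Rg [m lw2 [lv2 adj2]]]].
move=> /(lead_word k _ (in_R_in_N Rf))[-> ->].
move=> /(lead_word k _ (in_R_in_N Rg))[w12 ->].
rewrite -w12 in lw2 adj2 *.
(* Both sides are the distance from [v0] to the common vertex [w1], so [v1] and [v2] lie on the same
   level. *)
have [nm] : n.+1 = m.+1 := etrans (esym lw1) lw2.
rewrite -nm in lv2.
have -> := level_parent_unique tree_adj lw1 lv1 lv2 adj1 adj2.
(* The two relations now coincide, and so do their cofactors in the least common multiple. *)
by rewrite /= subrr; apply: lspan0.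
Qed.
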